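(* Let $U:[-1,1]\to\mathbb{R}$ be twice continuously differentiable. If $(\phi,c,\alpha^2)$, with $\phi$ not identically zero, $c=c_r+ic_i\in\mathbb{C}$ and $\alpha>0$, is a solution of the eigenvalue problem $$(U-c)(D^2-\alpha^2)\phi-(D^2U-\beta)\phi=\frac{1}{i\alpha R}(D^2-\alpha^2)^2\phi\quad\text{on }[-1,1],\qquad \phi=D\phi=0\ \text{ at } z=\pm1 ,$$ for given values of $R>0$ and $\beta\in\mathbb{R}$, and if $\alpha R$ is small enough, then the flow will be stable, i.e. $c_i<0$.
   Context: Here $D=d/dz$ is differentiation with respect to the real variable $z\in[-1,1]$, $(D^2-\alpha^2)\phi=\phi''-\alpha^2\phi$, and $(D^2-\alpha^2)^2\phi=\phi''''-2\alpha^2\phi''+\alpha^4\phi$. The function $\phi:[-1,1]\to\mathbb{C}$ is a classical solution; $c_r$ and $c_i$ are the real and imaginary parts of $c$. This is the eigenvalue problem for the linear stability of an incompressible viscous parallel shear flow with basic velocity distribution $U$ in the $\beta$-plane, with wave number $\alpha$, Reynolds number $R$, complex wave velocity $c$, and $\beta$ the derivative of the Coriolis force in the latitudinal direction. The statement gives no explicit threshold for ''small enough''. *)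

(* Defs.v *)
From Stdlib Require Import Reals.
From Coquelicot Require Import Coquelicot.
Open Scope R_scope.

(* Differentiation relative to a set [E]: only the values of [f] on [E] matter
   at points of [E], and at an endpoint of an interval the derivative is
   one-sided. *)
Definition is_derive_on {V : NormedModule R_AbsRing}
    (E : R -> Prop) (f : R -> V) (x : R) (l : V) : Prop :=
  filterdiff f (within E (locally x)) (fun y : R => scal y l).

Definition ex_derive_on {V : NormedModule R_AbsRing}
    (E : R -> Prop) (f : R -> V) (x : R) : Prop :=
  exists l : V, is_derive_on E f x l.

(* Unspecified where [f] is not differentiable relative to [E]. *)
Definition Derive_on {V : CompleteNormedModule R_AbsRing}
    (E : R -> Prop) (f : R -> V) (x : R) : V :=
  iota (is_derive_on E f x).

Fixpoint Derive_n_on {V : CompleteNormedModule R_AbsRing}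
    (E : R -> Prop) (f : R -> V) (n : nat) (x : R) : V :=
  match n with
  | O => f x
  | S k => Derive_on E (Derive_n_on E f k) x
  end.

Definition Cn_on {V : CompleteNormedModule R_AbsRing}
    (E : R -> Prop) (n : nat) (f : R -> V) : Prop :=
  (forall (k : nat) (x : R), (k < n)%nat -> E x ->
     ex_derive_on E (Derive_n_on E f k) x)
  /\ continuous_on E (Derive_n_on E f n).

(* Functions on [-1,1] are represented by total functions on R whose values
   outside [-1,1] are irrelevant. *)
Definition Icc (z : R) : Prop := -1 <= z <= 1.

Definition DR (n : nat) (U : R -> R) : R -> R :=
  Derive_n_on (V := R_CompleteNormedModule) Icc U n.

(* The variable z is real, so C is taken as a normed space over R. *)
Definition DC (n : nat) (phi : R -> C) : R -> C :=
  Derive_n_on (V := C_R_CompleteNormedModule) Icc phi n.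

Definition CnR (n : nat) (U : R -> R) : Prop :=
  Cn_on (V := R_CompleteNormedModule) Icc n U.

Definition CnC (n : nat) (phi : R -> C) : Prop :=
  Cn_on (V := C_R_CompleteNormedModule) Icc n phi.

Definition lap (alpha : R) (phi : R -> C) (z : R) : C :=
  (DC 2 phi z - RtoC (alpha ^ 2) * phi z)%C.

(* (D^2 - alpha^2)^2, expanded. *)
Definition bilap (alpha : R) (phi : R -> C) (z : R) : C :=
  (DC 4 phi z - RtoC (2 * alpha ^ 2) * DC 2 phi z
   + RtoC (alpha ^ 4) * phi z)%C.

Definition beta_plane_eigensolution (U : R -> R) (beta Rey alpha : R)
    (phi : R -> C) (c : C) : Prop :=
  CnC 4 phi /\
  (exists z : R, Icc z /\ phi z <> RtoC 0) /\
  (forall z : R, Icc z ->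
     ((RtoC (U z) - c) * lap alpha phi z - RtoC (DR 2 U z - beta) * phi z
      = 1 / (Ci * RtoC alpha * RtoC Rey) * bilap alpha phi z)%C) /\
  phi (-1) = RtoC 0 /\ phi 1 = RtoC 0 /\
  DC 1 phi (-1) = RtoC 0 /\ DC 1 phi 1 = RtoC 0.

(* Main.v *)
(** Multiply the equation by the conjugate of phi and take imaginary parts: the
    terms in U'' and beta are real and drop out, and up to exact derivatives of
    quantities vanishing at z = -1, 1 what remains is
    [c_i (|phi'|^2 + alpha^2 |phi|^2)
       + (alpha R)^-1 (|phi''|^2 + 2 alpha^2 |phi'|^2 + alpha^4 |phi|^2)
     = U' Im (phi' phi^* )].
    Poincare inequalities, obtained from the exact derivatives of z |phi|^2 and
    z |phi'|^2, let the viscous term absorb the right-hand side when alpha R is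
    small.  If c_i >= 0, the sum of all these exact derivatives is the derivative
    of a function vanishing at both ends and is at least |phi|^2 / 2, so phi = 0.
    Monotonicity of that function replaces integration throughout. *)
Require Import Defs.
From Stdlib Require Import Reals Lra Lia.
From Coquelicot Require Import Coquelicot.
Open Scope R_scope.

(** * Derivatives relative to [Icc] and ordinary derivatives at interior points *)

Lemma filter_within_Icc_interior (x : R) (P : R -> Prop) : -1 < x < 1 ->
  within Icc (locally x) P -> locally x P.
Proof.
  intros Hx H.
  assert (HI : locally x Icc).
  { apply (locally_interval _ x (-1) 1); simpl; try lra.
    intros y Hy1 Hy2; unfold Icc; lra. }
  generalize (filter_and (F := locally x) _ _ H HI); apply filter_imp.
  intros y [H1 H2]; exact (H1 H2).
Qed.

Lemma is_derive_on_interior {V : NormedModule R_AbsRing} (f : R -> V) (x : R) (l : V) :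
  -1 < x < 1 -> is_derive_on Icc f x l -> is_derive f x l.
Proof.
  intros Hx [Hlin Hdom]; split; [exact Hlin|].
  intros y Hy.
  apply (is_domin_le (F := within Icc (locally x))).
  - apply Hdom.
    intros P HP; apply filter_le_within; exact (Hy P HP).
  - intros P HP; exact (filter_within_Icc_interior x P Hx HP).
Qed.

(** The zero function [f - f] has derivative [l - m], so the linear map with slope [l - m] is
    dominated by every [eps]. *)
Lemma is_derive_uniq {V : NormedModule R_AbsRing} (f : R -> V) (x : R) (l m : V) :
  is_derive f x l -> is_derive f x m -> l = m.
Proof.
  intros Hl Hm.
  destruct (is_derive_minus f f x l m Hl Hm) as [_ Hdom].
  specialize (Hdom x (fun P HP => HP)).
  assert (Hd : norm (minus l m) = 0).
  { apply Rle_antisym; [|apply norm_ge_0].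
    apply le_epsilon; intros eps Heps; rewrite Rplus_0_l.
    destruct (Hdom (mkposreal eps Heps)) as [r Hr].
    specialize (Hr (x + r / 2)); cbn beta in Hr.
    pose proof (cond_pos r) as r0.
    assert (Hball : ball x r (x + r / 2)).
    { change (Rabs (x + r / 2 + - x) < r); rewrite Rabs_pos_eq; lra. }
    specialize (Hr Hball).
    rewrite !minus_eq_zero in Hr.
    unfold minus at 1 in Hr; rewrite plus_zero_l, norm_opp in Hr.
    change (norm (scal (x + r / 2 + - x) (minus l m))
      <= eps * Rabs (x + r / 2 + - x)) in Hr.
    replace (x + r / 2 + - x) with (r / 2) in Hr by ring.
    rewrite Rabs_pos_eq in Hr by lra.
    (* [norm_scal] only bounds the norm of a multiple from above, so the factor [r / 2] is undone by
       scaling back with [2 / r]. *)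
    assert (E : scal (2 / r) (scal (r / 2) (minus l m)) = minus l m).
    { rewrite scal_assoc.
      transitivity (scal (one (K := R_AbsRing)) (minus l m)); [|apply (scal_one (minus l m))].
      f_equal; change (2 / r * (r / 2) = 1); field; lra. }
    assert (Hs : norm (minus l m) <= Rabs (2 / r) * norm (scal (r / 2) (minus l m))).
    { rewrite <- E at 1; exact (norm_scal (K := R_AbsRing) (2 / r) _). }
    assert (0 < 2 / r) by (apply Rdiv_lt_0_compat; lra).
    rewrite Rabs_pos_eq in Hs by lra.
    eapply Rle_trans; [exact Hs|].
    replace eps with (2 / r * (eps * (r / 2))) by (field; lra).
    apply Rmult_le_compat_l; lra. }
  apply norm_eq_zero in Hd.
  apply (plus_reg_r (opp m)).
  rewrite plus_opp_r; exact Hd.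
Qed.

(** [iota] returns the derivative once it is known to be unique; uniqueness comes from the two-sided
    derivative. *)
Lemma Derive_on_interior {V : CompleteNormedModule R_AbsRing} (f : R -> V) (x : R) :
  -1 < x < 1 -> ex_derive_on Icc f x -> is_derive f x (Derive_on Icc f x).
Proof.
  intros Hx [l Hl].
  apply is_derive_on_interior; [exact Hx|].
  unfold Derive_on.
  rewrite (iota_unique (is_derive_on Icc f x) l); [exact Hl| |exact Hl].
  intros m Hm.
  apply (is_derive_uniq f x); apply is_derive_on_interior; assumption.
Qed.

Lemma ex_derive_on_continuous {V : NormedModule R_AbsRing} (f : R -> V) :
  (forall x, Icc x -> ex_derive_on Icc f x) -> continuous_on Icc f.
Proof.
  intros H x Hx.
  destruct (H x Hx) as [l Hl].
  apply filterdiff_continuous_aux.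
  - eexists; exact Hl.
  - intros P HP; apply filter_le_within; exact HP.
Qed.

(** * Boundedness and monotonicity on the closed interval *)

(** The retraction of the line onto [-1,1]. Composing with it turns continuity relative to [Icc]
    into continuity everywhere, as the extreme value and mean value theorems require. *)
Definition clamp (x : R) : R := Rmax (-1) (Rmin 1 x).

Lemma clamp_Icc (x : R) : Icc (clamp x).
Proof. unfold Icc, clamp, Rmax, Rmin; repeat destruct Rle_dec; lra. Qed.

Lemma clamp_id (x : R) : Icc x -> clamp x = x.
Proof. unfold Icc, clamp, Rmax, Rmin; repeat destruct Rle_dec; lra. Qed.

Lemma clamp_lipschitz (x y : R) : Rabs (clamp y - clamp x) <= Rabs (y - x).
Proof.
  unfold clamp, Rmax, Rmin; repeat destruct Rle_dec;
    unfold Rabs; repeat destruct Rcase_abs; lra.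
Qed.

Lemma continuous_clamp (f : R -> R) (x : R) :
  continuous_on Icc f -> continuity_pt (fun y => f (clamp y)) x.
Proof.
  intros Hf; apply continuity_pt_filterlim.
  apply (filterlim_comp _ _ _ clamp f _ (within Icc (locally (clamp x))));
    [|apply Hf, clamp_Icc].
  intros P [e He]; exists e; intros y Hy.
  apply He; [|apply clamp_Icc].
  eapply Rle_lt_trans; [apply clamp_lipschitz|exact Hy].
Qed.

Lemma continuous_on_Icc_bounded (f : R -> R) : continuous_on Icc f ->
  exists q, forall x, Icc x -> Rabs (f x) <= q.
Proof.
  intros Hf.
  destruct (continuity_ab_maj (fun x => Rabs (f (clamp x))) (-1) 1) as [m [Hm _]];
    [lra| |].
  - intros x _.
    apply (continuity_pt_comp (fun y => f (clamp y)) Rabs);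
      [apply continuous_clamp, Hf|apply Rcontinuity_abs].
  - exists (Rabs (f (clamp m))); intros x Hx.
    rewrite <- (clamp_id x Hx) at 1; exact (Hm x Hx).
Qed.

(** The mean value theorem for [F] composed with [clamp], with [dF] extended by 0 outside the open
    interval. *)
Lemma Icc_nondecreasing (F dF : R -> R) : continuous_on Icc F ->
  (forall x, -1 < x < 1 -> is_derive F x (dF x)) ->
  (forall x, -1 < x < 1 -> 0 <= dF x) ->
  forall x y, Icc x -> Icc y -> x <= y -> F x <= F y.
Proof.
  intros HF Hd Hpos x y [Hx1 Hx2] [Hy1 Hy2] Hxy.
  destruct (Req_dec x y) as [->|Hne]; [lra|].
  (* [MVT_gen] does not place the intermediate point in the open interval. *)
  destruct (MVT_gen (fun t => F (clamp t)) x y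
    (fun t => if Rlt_dec (-1) t then if Rlt_dec t 1 then dF t else 0 else 0))
    as [c [Hc E]].
  - rewrite Rmin_left, Rmax_right by lra; intros t Ht.
    destruct Rlt_dec; [|lra]; destruct Rlt_dec; [|lra].
    apply (is_derive_ext_loc F); [|apply Hd; lra].
    apply (locally_interval _ t (-1) 1); simpl; try lra.
    intros s Hs1 Hs2; rewrite clamp_id; unfold Icc; lra.
  - intros t _; apply continuous_clamp, HF.
  - rewrite !clamp_id in E by (unfold Icc; lra).
    assert (0 <= F y - F x); [|lra].
    rewrite E; apply Rmult_le_pos; [|lra].
    destruct Rlt_dec; [|lra]; destruct Rlt_dec; [|lra].
    apply Hpos; lra.
Qed.

(** Equal end values squeeze the monotone [F] to a constant. This stands in for the fact that a
    nonnegative function with zero integral vanishes. *)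
Lemma Icc_derivative_zero (F dF : R -> R) : continuous_on Icc F ->
  (forall x, -1 < x < 1 -> is_derive F x (dF x)) ->
  (forall x, -1 < x < 1 -> 0 <= dF x) ->
  F (-1) = F 1 -> forall x, -1 < x < 1 -> dF x = 0.
Proof.
  intros HF Hd Hpos E x Hx.
  assert (Hconst : forall y, Icc y -> F y = F 1).
  { intros y [Hy1 Hy2].
    assert (F (-1) <= F y)
      by (apply (Icc_nondecreasing F dF); try assumption; unfold Icc; lra).
    assert (F y <= F 1)
      by (apply (Icc_nondecreasing F dF); try assumption; unfold Icc; lra).
    lra. }
  rewrite <- (is_derive_unique F x _ (Hd x Hx)).
  apply is_derive_unique.
  apply (is_derive_ext_loc (fun _ => F 1)); [|apply @is_derive_const].
  apply (locally_interval _ x (-1) 1); simpl; try lra.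
  intros y Hy1 Hy2; symmetry; apply Hconst; unfold Icc; lra.
Qed.

(** * Algebra of continuous functions on a set *)

Lemma continuous_on_Rplus (E : R -> Prop) (f g : R -> R) :
  continuous_on E f -> continuous_on E g -> continuous_on E (fun x => f x + g x).
Proof.
  intros Hf Hg x Hx.
  apply (filterlim_comp_2 (G := locally (f x)) (H := locally (g x)) f g Rplus);
    [exact (Hf x Hx)|exact (Hg x Hx)|exact (filterlim_plus (f x) (g x))].
Qed.

Lemma continuous_on_Ropp (E : R -> Prop) (f : R -> R) :
  continuous_on E f -> continuous_on E (fun x => - f x).
Proof.
  intros Hf x Hx.
  apply (filterlim_comp _ _ _ f Ropp _ (locally (f x)));
    [exact (Hf x Hx)|exact (filterlim_opp (f x))].
Qed.

Lemma continuous_on_Rmult (E : R -> Prop) (f g : R -> R) :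
  continuous_on E f -> continuous_on E g -> continuous_on E (fun x => f x * g x).
Proof.
  intros Hf Hg x Hx.
  apply (filterlim_comp_2 (G := locally (f x)) (H := locally (g x)) f g Rmult);
    [exact (Hf x Hx)|exact (Hg x Hx)|exact (filterlim_mult (f x) (g x))].
Qed.

Lemma continuous_on_Rconst (E : R -> Prop) (a : R) : continuous_on E (fun _ : R => a).
Proof. intros x Hx; apply filterlim_const. Qed.

Lemma continuous_on_Rid (E : R -> Prop) : continuous_on E (fun x : R => x).
Proof. intros x Hx P HP; apply filter_le_within; exact HP. Qed.

(** * The energy estimate in real form *)

(** Here [u0 + i v0] is the eigenfunction, [s] is alpha^2, [k] is 1 / (alpha R) and [N] is U'' -
    beta. *)
Lemma real_energy_argument (U U' : R -> R) (u0 u1 u2 u3 u4 v0 v1 v2 v3 v4 : R -> R)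
    (q k s cr ci : R) (N : R -> R) :
  continuous_on Icc U ->
  continuous_on Icc u0 -> continuous_on Icc u1 ->
  continuous_on Icc u2 -> continuous_on Icc u3 ->
  continuous_on Icc v0 -> continuous_on Icc v1 ->
  continuous_on Icc v2 -> continuous_on Icc v3 ->
  (forall z, -1 < z < 1 -> is_derive U z (U' z)) ->
  (forall z, -1 < z < 1 -> is_derive u0 z (u1 z) /\ is_derive u1 z (u2 z) /\
     is_derive u2 z (u3 z) /\ is_derive u3 z (u4 z)) ->
  (forall z, -1 < z < 1 -> is_derive v0 z (v1 z) /\ is_derive v1 z (v2 z) /\
     is_derive v2 z (v3 z) /\ is_derive v3 z (v4 z)) ->
  (forall z, -1 < z < 1 -> Rabs (U' z) <= q) ->
  32 * (q + 1) <= k -> 0 <= q -> 0 <= s -> 0 <= ci ->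
  (forall z, -1 < z < 1 ->
     (U z - cr) * (u2 z - s * u0 z) + ci * (v2 z - s * v0 z) - N z * u0 z
     = k * (v4 z - 2 * s * v2 z + s ^ 2 * v0 z)) ->
  (forall z, -1 < z < 1 ->
     (U z - cr) * (v2 z - s * v0 z) - ci * (u2 z - s * u0 z) - N z * v0 z
     = - k * (u4 z - 2 * s * u2 z + s ^ 2 * u0 z)) ->
  u0 (-1) = 0 -> v0 (-1) = 0 -> u0 1 = 0 -> v0 1 = 0 ->
  u1 (-1) = 0 -> v1 (-1) = 0 -> u1 1 = 0 -> v1 1 = 0 ->
  forall z, -1 < z < 1 -> u0 z = 0 /\ v0 z = 0.
Proof.
  intros CU Cu0 Cu1 Cu2 Cu3 Cv0 Cv1 Cv2 Cv3 DU Du Dv Hq Hk q0 s0 ci0 Ere Eim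
    u0m v0m u0p v0p u1m v1m u1p v1p.
  (* The first three lines are the boundary terms of the integrations by parts, the last two the
     Poincare terms. Every product has a factor among [u0], [v0], [u1], [v1], so [F] vanishes at
     both ends. Only sums, opposites and products occur, to match the continuity lemmas. *)
  pose (F := fun z =>
    - ((U z + - cr) * (v1 z * u0 z + - (u1 z * v0 z)))
    + (ci + 2 * k * s) * (u0 z * u1 z + v0 z * v1 z)
    + - k * (u3 z * u0 z + v3 z * v0 z + - (u2 z * u1 z + v2 z * v1 z))
    + k / 4 * (z * (u1 z * u1 z + v1 z * v1 z))
    + k / 32 * (z * (u0 z * u0 z + v0 z * v0 z))).
  (* The derivative of [F] after the equation has eliminated the fourth derivatives. *)
  pose (dF := fun z =>
    - U' z * (v1 z * u0 z - u1 z * v0 z)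
    + ci * (u1 z ^ 2 + v1 z ^ 2 + s * (u0 z ^ 2 + v0 z ^ 2))
    + k * (u2 z ^ 2 + v2 z ^ 2 + 2 * s * (u1 z ^ 2 + v1 z ^ 2)
           + s ^ 2 * (u0 z ^ 2 + v0 z ^ 2))
    + k / 4 * (u1 z ^ 2 + v1 z ^ 2 + 2 * z * (u1 z * u2 z + v1 z * v2 z))
    + k / 32 * (u0 z ^ 2 + v0 z ^ 2 + 2 * z * (u0 z * u1 z + v0 z * v1 z))).
  assert (Hlow : forall z, -1 < z < 1 -> (u0 z ^ 2 + v0 z ^ 2) / 2 <= dF z).
  { intros z Hz; unfold dF.
    (* For [b] the derivative of [a], the right-hand side is the derivative of [z a^2]. The bound is
       half of [(a + 2 z b)^2 >= 0], with [z^2 <= 1]. *)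
    assert (Poincare : forall a b, a ^ 2 / 2 - 2 * b ^ 2 <= a ^ 2 + 2 * z * (a * b)).
    { intros a b.
      assert (0 <= (a + 2 * z * b) ^ 2) by apply pow2_ge_0.
      assert (0 <= b ^ 2 * (1 - z ^ 2))
        by (apply Rmult_le_pos; [apply pow2_ge_0|nra]).
      nra. }
    pose proof (Poincare (u1 z) (u2 z)) as P1.
    pose proof (Poincare (v1 z) (v2 z)) as P2.
    pose proof (Poincare (u0 z) (u1 z)) as P3.
    pose proof (Poincare (v0 z) (v1 z)) as P4.
    specialize (Hq z Hz).
    set (A := u0 z ^ 2 + v0 z ^ 2); set (B := u1 z ^ 2 + v1 z ^ 2).
    assert (HA : 0 <= A) by (unfold A; nra).
    assert (HB : 0 <= B) by (unfold B; nra).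
    assert (HW : - (q / 2 * (A + B)) <= - U' z * (v1 z * u0 z - u1 z * v0 z)
      <= q / 2 * (A + B)).
    { set (w := v1 z * u0 z - u1 z * v0 z).
      assert (- (A + B) <= 2 * w <= A + B).
      { unfold w, A, B.
        assert (0 <= (v1 z + u0 z) ^ 2 + (u1 z - v0 z) ^ 2)
          by (apply Rplus_le_le_0_compat; apply pow2_ge_0).
        assert (0 <= (v1 z - u0 z) ^ 2 + (u1 z + v0 z) ^ 2)
          by (apply Rplus_le_le_0_compat; apply pow2_ge_0).
        lra. }
      apply Rabs_le_between.
      rewrite Rabs_mult, Rabs_Ropp.
      replace (q / 2 * (A + B)) with (q * ((A + B) / 2)) by field.
      apply Rmult_le_compat; try apply Rabs_pos; [exact Hq|].
      apply Rabs_le_between; lra. }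
    assert (0 <= ci * (B + s * A))
      by (apply Rmult_le_pos; [lra|apply Rplus_le_le_0_compat; nra]).
    assert (0 <= k * (2 * s * B + s ^ 2 * A)).
    { apply Rmult_le_pos; [lra|].
      apply Rplus_le_le_0_compat; apply Rmult_le_pos; nra. }
    (* The weight [k / 4] spends half of the second-derivative term to gain [k B / 8]; the weight
       [k / 32] then spends half of that gain to obtain [k A / 64]. *)
    assert (k * (B / 8 - (u2 z ^ 2 + v2 z ^ 2) / 2) <=
      k / 4 * (B + 2 * z * (u1 z * u2 z + v1 z * v2 z)))
      by (unfold B; nra).
    assert (k * (A / 64 - B / 16) <=
      k / 32 * (A + 2 * z * (u0 z * u1 z + v0 z * v1 z)))
      by (unfold A, B; nra).
    assert (0 <= k * (u2 z ^ 2 + v2 z ^ 2)) by (apply Rmult_le_pos; nra).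
    (* The left side is [(q + 1) (A / 2 + 2 B)]: it absorbs the shear term, at most [q (A + B) / 2]
       in size, and still leaves [A / 2]. *)
    assert (32 * (q + 1) * (A / 64 + B / 16) <= k * (A / 64 + B / 16))
      by (apply Rmult_le_compat_r; lra).
    assert (0 <= q * B) by (apply Rmult_le_pos; lra).
    lra. }
  assert (HF : forall z, -1 < z < 1 -> is_derive F z (dF z)).
  { intros z Hz.
    destruct (Du z Hz) as (Du0 & Du1 & Du2 & Du3).
    destruct (Dv z Hz) as (Dv0 & Dv1 & Dv2 & Dv3).
    pose proof (DU z Hz) as DUz.
    unfold F; auto_derive.
    - repeat split; eexists; eassumption.
    - repeat match goal with
      | H : is_derive ?f z ?l |- _ =>
          replace (Derive (fun t : R => f t) z) with l
            by (symmetry; exact (is_derive_unique f z l H)); clear H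
      end.
      (* [E2] minus [E1] is the imaginary part of the equation times the conjugate of the
         eigenfunction; the [N] terms cancel in it. *)
      pose proof (f_equal (Rmult (v0 z)) (Ere z Hz)) as E1.
      pose proof (f_equal (Rmult (u0 z)) (Eim z Hz)) as E2.
      unfold dF; lra. }
  assert (CF : continuous_on Icc F).
  { unfold F.
    repeat first [assumption | apply continuous_on_Rplus | apply continuous_on_Ropp
      | apply continuous_on_Rconst | apply continuous_on_Rid
      | apply continuous_on_Rmult]. }
  intros z Hz.
  assert (Z : dF z = 0).
  { apply (Icc_derivative_zero F dF); try assumption.
    - intros x Hx; specialize (Hlow x Hx); nra.
    - unfold F; rewrite u0m, v0m, u0p, v0p, u1m, v1m, u1p, v1p; ring. }
  specialize (Hlow z Hz); split; nra.
Qed.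

(** * From complex-valued functions to real and imaginary parts *)

Lemma is_derive_Re (f : R -> C) (x : R) (l : C) :
  is_derive (V := C_R_NormedModule) f x l -> is_derive (fun y => Re (f y)) x (Re l).
Proof.
  intros H.
  apply (filterdiff_comp' (V := C_R_NormedModule) f Re x _ Re H).
  apply filterdiff_linear, (is_linear_fst (U := R_NormedModule) (V := R_NormedModule)).
Qed.

Lemma is_derive_Im (f : R -> C) (x : R) (l : C) :
  is_derive (V := C_R_NormedModule) f x l -> is_derive (fun y => Im (f y)) x (Im l).
Proof.
  intros H.
  apply (filterdiff_comp' (V := C_R_NormedModule) f Im x _ Im H).
  apply filterdiff_linear, (is_linear_snd (U := R_NormedModule) (V := R_NormedModule)).
Qed.

Lemma continuous_on_Re (E : R -> Prop) (f : R -> C) :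
  continuous_on (U := C_R_NormedModule) E f -> continuous_on E (fun x => Re (f x)).
Proof.
  intros H x Hx.
  apply (filterlim_comp _ _ _ f Re _ (locally (f x)) _ (H x Hx)).
  intros P [e He]; exists e; intros y [Hy _]; exact (He _ Hy).
Qed.

Lemma continuous_on_Im (E : R -> Prop) (f : R -> C) :
  continuous_on (U := C_R_NormedModule) E f -> continuous_on E (fun x => Im (f x)).
Proof.
  intros H x Hx.
  apply (filterlim_comp _ _ _ f Im _ (locally (f x)) _ (H x Hx)).
  intros P [e He]; exists e; intros y [_ Hy]; exact (He _ Hy).
Qed.

Lemma Cn_on_continuous {V : CompleteNormedModule R_AbsRing} (n k : nat) (f : R -> V) :
  Cn_on Icc n f -> (k < n)%nat -> continuous_on Icc (Derive_n_on Icc f k).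
Proof.
  intros [H _] Hk; apply (ex_derive_on_continuous (Derive_n_on Icc f k));
    intros x Hx; exact (H k x Hk Hx).
Qed.

Lemma Cn_on_is_derive {V : CompleteNormedModule R_AbsRing} (n k : nat) (f : R -> V)
    (x : R) : Cn_on Icc n f -> (k < n)%nat -> -1 < x < 1 ->
  is_derive (Derive_n_on Icc f k) x (Derive_n_on Icc f (S k) x).
Proof.
  intros [H _] Hk Hx; apply Derive_on_interior; [exact Hx|].
  apply H; [exact Hk|unfold Icc; lra].
Qed.

Lemma inv_Ci_mult (a b : R) : 0 < a -> 0 < b ->
  (1 / (Ci * RtoC a * RtoC b))%C = (0, - / (a * b)).
Proof.
  intros Ha Hb.
  apply injective_projections; simpl; field; lra.
Qed.

(** Since 1/i = -i, the viscous term crosses over: its imaginary part enters the real equation, and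
    its real part, negated, the imaginary one. The power [(alpha ^ 2) ^ 2] matches [s ^ 2] in the
    energy estimate. *)
Lemma eigenvalue_equation_parts (x n alpha Rey : R) (c p0 p2 p4 : C) :
  0 < alpha -> 0 < Rey ->
  ((RtoC x - c) * (p2 - RtoC (alpha ^ 2) * p0) - RtoC n * p0
   = 1 / (Ci * RtoC alpha * RtoC Rey)
     * (p4 - RtoC (2 * alpha ^ 2) * p2 + RtoC (alpha ^ 4) * p0))%C ->
  (x - Re c) * (Re p2 - alpha ^ 2 * Re p0) + Im c * (Im p2 - alpha ^ 2 * Im p0)
    - n * Re p0
  = / (alpha * Rey) * (Im p4 - 2 * alpha ^ 2 * Im p2 + (alpha ^ 2) ^ 2 * Im p0)
  /\
  (x - Re c) * (Im p2 - alpha ^ 2 * Im p0) - Im c * (Re p2 - alpha ^ 2 * Re p0)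
    - n * Im p0
  = - / (alpha * Rey) * (Re p4 - 2 * alpha ^ 2 * Re p2 + (alpha ^ 2) ^ 2 * Re p0).
Proof.
  intros Ha HR; rewrite inv_Ci_mult by assumption.
  generalize (/ (alpha * Rey)); intros k.
  destruct c, p0, p2, p4; intros H.
  unfold Cmult, Cminus, Cplus, Copp, RtoC in H; cbn [fst snd] in H.
  apply pair_equal_spec in H; destruct H; cbn [Re Im fst snd].
  split; lra.
Qed.

(** * Choice of the threshold and conclusion *)

Theorem theorem4 : forall U : R -> R, CnR 2 U ->
  exists eps : R, 0 < eps /\
    forall (beta Rey alpha : R) (phi : R -> C) (c : C),
      0 < Rey -> 0 < alpha ->
      beta_plane_eigensolution U beta Rey alpha phi c ->
      alpha * Rey < eps ->
      Im c < 0.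
Proof.
  intros U HU.
  destruct (continuous_on_Icc_bounded (DR 1 U)) as [q Hq].
  { apply (Cn_on_continuous (V := R_CompleteNormedModule) 2); [exact HU|lia]. }
  assert (q0 : 0 <= q).
  { eapply Rle_trans; [apply Rabs_pos|apply (Hq 0)]; unfold Icc; lra. }
  (* The threshold depends only on the bound [q] for |U'|; inverting it gives the lower bound on [k]
     in the energy estimate. *)
  exists (/ (32 * (q + 1))); split; [apply Rinv_0_lt_compat; lra|].
  intros beta Rey alpha phi c HR Ha (Hphi & [z0 [Hz0 Hnz]] & Heq & Bm & Bp & Bm' & Bp') Hsmall.
  apply Rnot_le_lt; intros ci0.
  pose (k := / (alpha * Rey)).
  assert (HaR : 0 < alpha * Rey) by (apply Rmult_lt_0_compat; assumption).
  assert (Hk : 32 * (q + 1) <= k).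
  { unfold k; rewrite <- (Rinv_inv (32 * (q + 1))).
    apply Rinv_le_contravar; lra. }
  assert (Creg : forall j, (j < 4)%nat -> continuous_on (U := C_R_NormedModule) Icc (DC j phi))
    by (intros j Hj; apply (Cn_on_continuous (V := C_R_CompleteNormedModule) 4); assumption).
  assert (Dreg : forall j z, (j < 4)%nat -> -1 < z < 1 ->
      is_derive (V := C_R_NormedModule) (DC j phi) z (DC (S j) phi z))
    by (intros j z Hj Hz; apply (Cn_on_is_derive (V := C_R_CompleteNormedModule) 4); assumption).
  assert (Dre : forall j z, (j < 4)%nat -> -1 < z < 1 ->
      is_derive (fun y => Re (DC j phi y)) z (Re (DC (S j) phi z)))
    by (intros j z Hj Hz; exact (is_derive_Re _ _ _ (Dreg j z Hj Hz))).
  assert (Dim : forall j z, (j < 4)%nat -> -1 < z < 1 ->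
      is_derive (fun y => Im (DC j phi y)) z (Im (DC (S j) phi z)))
    by (intros j z Hj Hz; exact (is_derive_Im _ _ _ (Dreg j z Hj Hz))).
  pose proof (fun z (Hz : -1 < z < 1) =>
    eigenvalue_equation_parts _ _ _ _ _ _ _ _ Ha HR
      (Heq z (conj (Rlt_le _ _ (proj1 Hz)) (Rlt_le _ _ (proj2 Hz))))) as Heq_parts.
  assert (Zero : forall z, -1 < z < 1 -> Re (phi z) = 0 /\ Im (phi z) = 0).
  { apply (real_energy_argument U (DR 1 U)
      (fun z => Re (DC 0 phi z)) (fun z => Re (DC 1 phi z)) (fun z => Re (DC 2 phi z))
      (fun z => Re (DC 3 phi z)) (fun z => Re (DC 4 phi z))
      (fun z => Im (DC 0 phi z)) (fun z => Im (DC 1 phi z)) (fun z => Im (DC 2 phi z))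
      (fun z => Im (DC 3 phi z)) (fun z => Im (DC 4 phi z))
      q k (alpha ^ 2) (Re c) (Im c) (fun z => DR 2 U z - beta));
      try (apply continuous_on_Re, Creg; lia);
      try (apply continuous_on_Im, Creg; lia);
      try assumption.
    - apply (Cn_on_continuous (V := R_CompleteNormedModule) 2 0 U HU); lia.
    - intros z Hz; apply (Cn_on_is_derive (V := R_CompleteNormedModule) 2 0 U z HU);
        [lia|exact Hz].
    - intros z Hz; repeat split; apply Dre; lia || exact Hz.
    - intros z Hz; repeat split; apply Dim; lia || exact Hz.
    - intros z Hz; apply Hq; unfold Icc; lra.
    - apply pow2_ge_0.
    - intros z Hz; apply (Heq_parts z Hz).
    - intros z Hz; apply (Heq_parts z Hz).
    - exact (f_equal Re Bm).
    - exact (f_equal Im Bm).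
    - exact (f_equal Re Bp).
    - exact (f_equal Im Bp).
    - exact (f_equal Re Bm').
    - exact (f_equal Im Bm').
    - exact (f_equal Re Bp').
    - exact (f_equal Im Bp'). }
  apply Hnz.
  (* The energy estimate covers interior points; at an endpoint [phi] vanishes by the boundary
     conditions. *)
  destruct Hz0 as [[Hl|<-] [Hr| ->]]; try assumption.
  destruct (Zero z0 (conj Hl Hr)).
  apply injective_projections; assumption.
Qed.
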